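(* Let $$P(\theta)=\sum_{j=0}^{k} a_j\cos(j\theta)+\sum_{j=1}^{k} b_j\sin(j\theta)$$ be a non-negative trigonometric polynomial of degree $k$ (i.e. $P(\theta)\ge 0$ for all real $\theta$), with real coefficients $a_0,\dots,a_k,b_1,\dots,b_k$. Suppose that $F$ is a cumulative distribution function on $\mathbb{R}$ and $f$ is its characteristic function. Then for any $s>0$ $$1-F(2\pi/s)+F(-2\pi/s)\le \frac{2}{s\,a_0}\Bigl(\sum_{j=0}^{k} a_j\int_0^s \operatorname{Re} f(ju)\,du+\sum_{j=1}^{k} b_j\int_0^s \operatorname{Im} f(ju)\,du\Bigr).$$
   Context: The characteristic function of a distribution function $F$ is $f(t)=\int_{-\infty}^{\infty}e^{itx}\,dF(x)$, $t\in\mathbb{R}$. A trigonometric polynomial of degree $k$ (with $k\ge 0$ an integer) is one whose top coefficients $a_k,b_k$ are not both zero (for $k=0$: $a_0\neq 0$); in particular $P$ is not identically zero. *)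

(* Defs.v *)
From HB Require Import structures.
From mathcomp Require Import all_boot all_order all_algebra.
From mathcomp Require Import complex.
From mathcomp Require Import all_classical all_reals all_analysis.

Set Implicit Arguments.
Unset Strict Implicit.
Unset Printing Implicit Defensive.

Import Order.TTheory GRing.Theory Num.Theory.
Import numFieldNormedType.Exports.

Local Open Scope classical_set_scope.
Local Open Scope ring_scope.
Local Open Scope complex_scope.

(* Coefficients are indexed by nat; only a_0, ..., a_k and b_1, ..., b_k are
   used, so b 0 is irrelevant. *)
Definition trig_poly (R : realType) (k : nat) (a b : nat -> R) (theta : R) : R :=
  \sum_(0 <= j < k.+1) a j * cos (j%:R * theta) +
  \sum_(1 <= j < k.+1) b j * sin (j%:R * theta).

Definition trig_degree (R : realType) (k : nat) (a b : nat -> R) : Prop :=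
  if k is 0%N then a 0%N <> 0 else ~ (a k = 0 /\ b k = 0).

Definition cexp (R : realType) (z : R[i]) : R[i] :=
  (expR (complex.Re z))%:C * (cos (complex.Im z) +i* sin (complex.Im z)).

(* As for Rintegral, an undefined or infinite real or imaginary part is sent to
   a junk value; this does not occur for bounded measurable integrands and
   finite measures. *)
Definition cintegral d (T : measurableType d) (R : realType)
    (mu : {measure set T -> \bar R}) (D : set T) (g : T -> R[i]) : R[i] :=
  (\int[mu]_(x in D) complex.Re (g x)) +i* (\int[mu]_(x in D) complex.Im (g x)).

(* A distribution function is a nondecreasing, right-continuous function with
   limits 0 at -oo and 1 at +oo, i.e. F x = P(X <= x). *)
Definition char_fun (R : realType) (F : cumulativeBounded (0 : R) (1 : R))
    (t : R) : R[i] :=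
  cintegral (lebesgue_stieltjes_measure F) setT
    (fun x => cexp (0 +i* (t * x))).

(* Main.v *)
Require Import Defs.
From HB Require Import structures.
From mathcomp Require Import all_boot all_order all_algebra.
From mathcomp Require Import complex.
From mathcomp Require Import all_classical all_reals all_analysis.
From mathcomp Require Import measurable_realfun.
From mathcomp Require Import ring lra.

Import Order.TTheory GRing.Theory Num.Theory.
Import numFieldNormedType.Exports.

Local Open Scope classical_set_scope.
Local Open Scope ring_scope.

(* By Fubini the bracket on the right-hand side is the expectation under F of
   S(x) = \int_0^s P(x u) du >= 0, so by Markov's inequality it suffices that
   S(x) >= s a_0 / 2 when |x| >= 2 pi / s.  The primitive Q of P is nondecreasing
   and satisfies Q(t + 2 pi) = Q(t) + 2 pi a_0; since [0, y] with y >= 2 pi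
   contains n >= 1 full periods with n * 2 pi >= y / 2, Q grows by at least
   a_0 y / 2 there, and S(x) = (Q(x s) - Q(0)) / x. *)

Lemma is_derive_mulr {R : realType} (c t : R) : is_derive t 1 ( *%R c) c.
Proof.
apply: (is_derive_eq (is_deriveZ c (is_derive_id t 1))).
by rewrite /GRing.scale/= mulr1.
Qed.

(** * Trigonometric polynomials: averages over equispaced points and positivity of the mean *)

Section TrigPoly.
Context {R : realType} (k : nat) (a b : nat -> R).

Lemma trig_polyE (t : R) : trig_poly k a b t =
  a 0%N + \sum_(1 <= j < k.+1) (a j * cos (j%:R * t) + b j * sin (j%:R * t)).
Proof.
by rewrite /trig_poly big_ltn// mul0r cos0 mulr1 -addrA -big_split.
Qed.

(** Since [2 * sin (h / 2) * cos v = sin (v + h / 2) - sin (v - h / 2)], each term is a difference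
    of consecutive values of [u]. *)
Lemma sum_cos_telescope (h p : R) (n : nat) :
  2 * sin (h / 2) * \sum_(0 <= m < n) cos (p + m%:R * h) =
  sin (p + n%:R * h - h / 2) - sin (p - h / 2).
Proof.
pose u m := sin (p + m%:R * h - h / 2).
have -> : sin (p - h / 2) = u 0%N by rewrite /u mul0r addr0.
rewrite -[sin _ in RHS]/(u n) -telescope_sumr// mulr_sumr.
apply: eq_bigr => m _; rewrite /u.
have -> : p + m.+1%:R * h - h / 2 = (p + m%:R * h) + h / 2.
  by rewrite -natr1; field.
by rewrite sinD sinB; ring.
Qed.

Lemma sin_addn2pi (t : R) (n : nat) : sin (t + n%:R * (2 * pi)) = sin t.
Proof.
by rewrite [2 * pi]mulr_natl [n%:R * _]mulr_natl (periodicn (@sinD2pi R)).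
Qed.

Lemma cos_addn2pi (t : R) (n : nat) : cos (t + n%:R * (2 * pi)) = cos t.
Proof.
by rewrite [2 * pi]mulr_natl [n%:R * _]mulr_natl (periodicn (@cosD2pi R)).
Qed.

(** The endpoints of the telescoped sum differ by [j] full turns. The factor [sin (h / 2)] can be
    cancelled because [h / 2 = j * pi / n] lies strictly between 0 and [pi]. *)
Lemma sum_cos_equispaced (n j : nat) (p : R) : (0 < j < n)%N ->
  \sum_(0 <= m < n) cos (p + m%:R * (j%:R / n%:R * (2 * pi))) = 0.
Proof.
move=> /andP[j0 jn]; set h := _ * (2 * pi).
have np : (0 < n)%N by rewrite (leq_trans _ jn).
have n0 : n%:R != 0 :> R by rewrite pnatr_eq0 -lt0n.
have s0 : 2 * sin (h / 2) != 0.
  rewrite mulf_neq0 ?pnatr_eq0// gt_eqF//; apply: sin_gt0_pi.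
  have -> : h / 2 = j%:R / n%:R * pi by rewrite /h; field.
  rewrite mulr_gt0 ?pi_gt0 ?divr_gt0 ?ltr0n//=.
  by rewrite gtr_pMl ?pi_gt0// ltr_pdivrMr ?ltr0n// mul1r ltr_nat.
apply: (mulfI s0); rewrite mulr0 sum_cos_telescope.
have -> : p + n%:R * h - h / 2 = p - h / 2 + j%:R * (2 * pi).
  by rewrite /h; field.
by rewrite sin_addn2pi subrr.
Qed.

Lemma sum_sin_equispaced (n j : nat) (p : R) : (0 < j < n)%N ->
  \sum_(0 <= m < n) sin (p + m%:R * (j%:R / n%:R * (2 * pi))) = 0.
Proof.
move=> jn; rewrite -[RHS](sum_cos_equispaced _ _ (p - pi / 2) jn).
by apply: eq_bigr => m _; rewrite addrAC cosBpihalf.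
Qed.

(* Averaging over k equispaced translates kills the harmonics 1, ..., k-1; the
   resulting inequality a_0 + a_k cos t + b_k sin t >= 0 forces a_0 > 0. *)
Lemma sum_trig_poly_equispaced (t : R) : (0 < k)%N ->
  \sum_(0 <= m < k) trig_poly k a b (t + m%:R * (2 * pi / k%:R)) =
  k%:R * (a 0%N + (a k * cos (k%:R * t) + b k * sin (k%:R * t))).
Proof.
move=> k0; have k0' : k%:R != 0 :> R by rewrite pnatr_eq0 -lt0n.
set h := 2 * pi / k%:R.
under eq_bigr do rewrite trig_polyE.
rewrite big_split/= sumr_const_nat subn0 exchange_big_nat/= mulrDr.
rewrite -[a 0%N *+ k]mulr_natl; congr (_ + _).
(* The harmonic [j = k] is split off: each translate shifts its phase by a multiple of [2 * pi], so
   all [k] of its terms coincide. *)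
rewrite big_nat_recr//= big_nat big1 ?add0r => [|j jk].
  transitivity (\sum_(0 <= m < k) (a k * cos (k%:R * t) + b k * sin (k%:R * t))).
    apply: eq_bigr => m _.
    have -> : k%:R * (t + m%:R * h) = k%:R * t + m%:R * (2 * pi).
      by rewrite /h; field.
    by rewrite cos_addn2pi sin_addn2pi.
  by rewrite sumr_const_nat subn0 [RHS]mulr_natl.
have E m : j%:R * (t + m%:R * h) =
    j%:R * t + m%:R * (j%:R / k%:R * (2 * pi)) by rewrite /h; field.
rewrite big_split/= -!mulr_sumr.
under eq_bigr do rewrite E.
under [X in _ + _ * X]eq_bigr do rewrite E.
by rewrite sum_cos_equispaced// sum_sin_equispaced// !mulr0 addr0.
Qed.

Lemma continuous_trig_poly : continuous (trig_poly k a b).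
Proof.
have cl (c : R) : continuous ( *%R c) by exact: mulrl_continuous.
move=> t; apply: cvgD; (apply: cvg_big => [|j _]; first exact: add_continuous).
  apply: cvgM; first exact: cvg_cst.
  by apply: (continuous_comp (cl _ t)); exact: continuous_cos.
apply: cvgM; first exact: cvg_cst.
by apply: (continuous_comp (cl _ t)); exact: continuous_sin.
Qed.

Hypothesis Pge0 : forall t : R, 0 <= trig_poly k a b t.

Lemma trig_poly_coef0_gt0 : trig_degree k a b -> 0 < a 0%N.
Proof.
move=> dP; case: (posnP k) => [k0|k0].
  move: dP; rewrite /trig_degree k0 => /eqP a0.
  have := Pge0 0; rewrite trig_polyE k0 big_geq// addr0 => a0ge.
  by rewrite lt_neqAle eq_sym a0.
have kp : 0 < k%:R :> R by rewrite ltr0n.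
(* The average is taken at [t / k], so that the surviving harmonic has argument [t]. *)
have avg t : 0 <= a 0%N + (a k * cos t + b k * sin t).
  have := sum_trig_poly_equispaced (t / k%:R) k0.
  rewrite mulrCA divff ?gt_eqF// mulr1 => E.
  rewrite -(pmulr_rge0 _ kp) -E.
  by apply: sumr_ge0 => m _; exact: Pge0.
(* These four angles give [a 0 + a k], [a 0 - a k], [a 0 + b k] and [a 0 - b k] non-negative; with
   [a 0 <= 0] this forces [a k = b k = 0], against the degree condition. *)
have := avg 0; have := avg pi; have := avg (pi / 2); have := avg (- (pi / 2)).
rewrite cos0 sin0 cospi sinpi cosN sinN cos_pihalf sin_pihalf => h1 h2 h3 h4.
rewrite ltNge; apply/negP => a0.
case: k k0 dP h1 h2 h3 h4 {avg kp} => // k' _ dP h1 h2 h3 h4.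
by apply: dP; split; lra.
Qed.

(** * The primitive of the polynomial and its growth *)

(** The termwise antiderivative, not normalised to vanish at 0; hence the differences with
    [trig_primitive 0] below. *)
Definition trig_primitive (t : R) : R := a 0%N * t +
  \sum_(1 <= j < k.+1) j%:R^-1 * (a j * sin (j%:R * t) - b j * cos (j%:R * t)).

Lemma is_derive_trig_primitive (t : R) :
  is_derive t 1 trig_primitive (trig_poly k a b t).
Proof.
rewrite trig_polyE.
have -> : trig_primitive = (fun t => a 0%N * t) + \sum_(i < k)
    (fun t => i.+1%:R^-1 * (a i.+1 * sin (i.+1%:R * t) - b i.+1 * cos (i.+1%:R * t))).
  apply/funext => u; rewrite /trig_primitive big_add1/= big_mkord.
  by rewrite fctE fct_sumE.
rewrite big_add1/= big_mkord; apply: is_deriveD.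
  exact: is_derive_mulr.
apply: is_derive_sum => i.
have i0 : i.+1%:R != 0 :> R by rewrite pnatr_eq0.
have ds := is_derive1_comp (is_derive_sin (i.+1%:R * t)) (is_derive_mulr i.+1%:R t).
have dc := is_derive1_comp (is_derive_cos (i.+1%:R * t)) (is_derive_mulr i.+1%:R t).
apply: (is_derive_eq (is_deriveZ _ (is_deriveB (is_deriveZ _ ds) (is_deriveZ _ dc)))).
by rewrite /GRing.scale/=; field.
Qed.

Lemma le_trig_primitive : {homo trig_primitive : x y / x <= y}.
Proof.
move=> x y xy; have d z := is_derive_trig_primitive z.
apply: (@ger0_derive1_ndecr _ _ x y) => // [z _|].
- by rewrite derive1E derive_val.
- by apply: derivable_within_continuous => z _; exact: ex_derive.
Qed.

Lemma trig_primitive_addn2pi (t : R) (n : nat) :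
  trig_primitive (t + n%:R * (2 * pi)) = trig_primitive t + a 0%N * (n%:R * (2 * pi)).
Proof.
rewrite /trig_primitive mulrDr -!addrA; congr (_ + _); rewrite addrC; congr (_ + _).
apply: eq_bigr => j _; rewrite [j%:R * (_ + _)]mulrDr [_ * (n%:R * _)]mulrA -natrM.
by rewrite sin_addn2pi cos_addn2pi.
Qed.

(** Take for [n] the integer part of [y / (2 * pi)]: as [n >= 1],
    [y / (2 * pi) < n + 1 <= 2 * n]. *)
Lemma half_periods (y : R) : 2 * pi <= y ->
  exists n : nat, n%:R * (2 * pi) <= y <= 2 * (n%:R * (2 * pi)).
Proof.
move=> hy; have p0 : 0 < 2 * pi :> R by rewrite mulr_gt0// pi_gt0.
have y0 : 0 <= y / (2 * pi) by rewrite divr_ge0 ?(le_trans _ hy)// ltW.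
exists (Num.truncn (y / (2 * pi))).
have /andP[n1 n2] := truncn_itv y0.
have n3 : (0 < Num.truncn (y / (2 * pi)))%N.
  by rewrite truncn_gt0 ler_pdivlMr// mul1r.
move: n1 n2; rewrite ler_pdivlMr// ltr_pdivrMr// => n1 n2.
rewrite n1/= (le_trans (ltW n2))// mulrA ler_pM2r//.
by rewrite -natrM ler_nat mul2n -addnn -addn1 leq_add2l.
Qed.

(** The factor [Num.sg y] treats both directions at once: by monotonicity [y] is compared with the
    last whole number of periods between 0 and [y], on the right or on the left of 0. *)
Lemma trig_primitive_growth (y : R) : 0 <= a 0%N -> 2 * pi <= `|y| ->
  a 0%N * `|y| / 2 <= (trig_primitive y - trig_primitive 0) * Num.sg y.
Proof.
move=> a0; case: (ltrgt0P y) => [y0|y0|->]; last first.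
- by rewrite sgr0 !mulr0 mul0r.
- rewrite ltr0_sg// => /half_periods[n /andP[n1 n2]].
  have le1 : trig_primitive y <= trig_primitive (- (n%:R * (2 * pi))).
    by apply: le_trig_primitive; lra.
  have := trig_primitive_addn2pi (- (n%:R * (2 * pi))) n.
  rewrite addNr => E.
  have := ler_wpM2l a0 n2; lra.
- rewrite gtr0_sg// => /half_periods[n /andP[n1 n2]].
  have le1 := le_trig_primitive _ _ n1.
  have := trig_primitive_addn2pi 0 n.
  rewrite add0r => E.
  have := ler_wpM2l a0 n2; lra.
Qed.

Lemma Rintegral_trig_poly (x s : R) : x != 0 -> 0 < s ->
  \int[lebesgue_measure]_(u in `[0, s]) trig_poly k a b (x * u) =
  (trig_primitive (x * s) - trig_primitive 0) / x.
Proof.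
move=> x0 s0.
(* The substitution [v = x * u] is built into this antiderivative, which serves both signs of
   [x]. *)
pose G (u : R) := x^-1 * trig_primitive (x * u).
have dG (u : R) : is_derive u 1 G (trig_poly k a b (x * u)).
  have dQ := is_derive1_comp (is_derive_trig_primitive (x * u)) (is_derive_mulr x u).
  apply: (is_derive_eq (is_deriveZ _ dQ)).
  by rewrite /GRing.scale/=; field.
have cP : continuous (fun u => trig_poly k a b (x * u)).
  move=> u; apply: (@continuous_comp _ _ _ ( *%R x) (trig_poly k a b)).
    exact: mulrl_continuous.
  exact: continuous_trig_poly.
rewrite /Rintegral (@continuous_FTC2 _ _ G)//=.
- by rewrite /G mulr0 -mulrBr mulrC.
- exact: continuous_subspaceT.
- split.
  + by move=> z _; exact: ex_derive.
  + apply: cvg_at_right_filter; apply: differentiable_continuous.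
    by apply/derivable1_diffP; exact: ex_derive.
  + apply: cvg_at_left_filter; apply: differentiable_continuous.
    by apply/derivable1_diffP; exact: ex_derive.
- by move=> z _; rewrite derive1E derive_val.
Qed.

Lemma Rintegral_trig_poly_ge (x s : R) : 0 <= a 0%N -> 0 < s ->
  2 * pi / s <= `|x| ->
  s * a 0%N / 2 <=
  \int[lebesgue_measure]_(u in `[0, s]) trig_poly k a b (x * u).
Proof.
move=> a0 s0 sx.
have x0 : 0 < `|x| by rewrite (lt_le_trans _ sx)// divr_gt0// mulr_gt0// pi_gt0.
rewrite Rintegral_trig_poly -?normr_gt0//.
have xs : 2 * pi <= `|x * s| by rewrite normrM (gtr0_norm s0) -ler_pdivrMr.
have := trig_primitive_growth (x * s) a0 xs.
rewrite sgrM (gtr0_sg s0) mulr1 normrM (gtr0_norm s0) => le_growth.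
(* Multiplying by the absolute value of [x] turns [D / x] into [D * Num.sg x], the form of the
   growth bound at [x * s], which has the sign of [x]. *)
rewrite -(ler_pM2r x0); set D := _ - _ in le_growth *.
have -> : D / x * `|x| = D * Num.sg x.
  by rewrite normrEsg mulrCA divfK -?normr_gt0// mulrC.
by apply: le_trans le_growth; lra.
Qed.

End TrigPoly.

(** * Real-valued integrals: linear combinations, exchange of order, half-open intervals *)

Lemma Rintegral_lincomb {d} {T : measurableType d} {R : realType}
    (mu : {measure set T -> \bar R}) (D : set T) (I : Type) (r : seq I)
    (c : I -> R) (f : I -> T -> R) :
  measurable D -> (forall i, mu.-integrable D (EFin \o f i)) ->
  mu.-integrable D (EFin \o (fun x => \sum_(i <- r) c i * f i x)) /\
  \int[mu]_(x in D) (\sum_(i <- r) c i * f i x) =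
  \sum_(i <- r) c i * \int[mu]_(x in D) f i x.
Proof.
move=> mD intf; elim: r => [|i r [intr IHr]].
  split; last first.
    by rewrite big_nil; under eq_Rintegral do rewrite big_nil;
       rewrite Rintegral_cst// mul0r.
  by under eq_fun do rewrite big_nil; exact: integrable0.
have intci : mu.-integrable D (EFin \o (fun x => c i * f i x)).
  exact: (integrableZl mD (c i) (intf i)).
split.
  under eq_fun do rewrite big_cons.
  exact: (integrableD mD intci intr).
under eq_Rintegral do rewrite big_cons.
by rewrite RintegralD// RintegralZl// IHr big_cons.
Qed.

(** A bounded measurable function is integrable on [setT]*[A], which has finite product measure, so
    Fubini applies. *)
Lemma Rintegral_bounded_Fubini {d1 d2} {T1 : measurableType d1}
    {T2 : measurableType d2} {R : realType}
    (m1 : {finite_measure set T1 -> \bar R})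
    (m2 : {sigma_finite_measure set T2 -> \bar R})
    (A : set T2) (g : T1 * T2 -> R) (M : R) :
  measurable A -> (m2 A < +oo)%E -> measurable_fun setT g ->
  (forall z, `|g z| <= M) ->
  m1.-integrable setT (EFin \o (fun x => \int[m2]_(y in A) g (x, y))) /\
  \int[m2]_(y in A) (\int[m1]_x g (x, y)) =
  \int[m1]_x (\int[m2]_(y in A) g (x, y)).
Proof.
move=> mA Afin mg gM.
have m1fin : (m1 setT < +oo)%E by rewrite ltey_eq fin_num_measure.
have bd (U : Type) (h : U -> T1 * T2) (B : set U) : [bounded (g \o h) x | x in B].
  by exists M; split; rewrite ?num_real// => N MN u _; apply: le_trans (gM _) (ltW MN).
have TA : ((m1 \x m2)%E (setT `*` A) < +oo)%E.
  by rewrite product_measure1E// lte_mul_pinfty// ge0_fin_numE.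
(* Extension by zero outside the strip, since Fubini is applied on the whole product. *)
pose f := (EFin \o g) \_ (setT `*` A).
have intf : (m1 \x m2)%E.-integrable setT f.
  apply: (integrable_mkcond _ (measurableX measurableT mA)).1.
  apply: measurable_bounded_integrable.
  - exact: measurableX.
  - exact: TA.
  - exact: measurable_funTS.
  - exact: (bd _ id).
have int1 y : m1.-integrable setT (EFin \o (fun x => g (x, y))).
  apply: measurable_bounded_integrable => //; last exact: (bd _ (fun x => (x, y))).
  by apply: measurableT_comp.
have int2 x : m2.-integrable A (EFin \o (fun y => g (x, y))).
  apply: measurable_bounded_integrable => //; last exact: (bd _ (fun y => (x, y))).
  by apply: measurable_funTS; apply: measurableT_comp.
(* Each section is integrable, so [fine] loses nothing when passing from extended to real
   integrals. *)
have F x : (\int[m2]_y f (x, y))%E = (\int[m2]_(y in A) g (x, y))%:E.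
  rewrite /Rintegral (fineK (integrable_fin_num mA (int2 x))) [RHS]integral_mkcond.
  by apply: eq_integral => y _; rewrite /f !patchE in_setX in_setT.
have G y : (\int[m1]_x f (x, y))%E = ((EFin \o (fun y => \int[m1]_x g (x, y))) \_ A) y.
  rewrite patchE; case: ifPn => yA /=.
    rewrite /Rintegral (fineK (integrable_fin_num measurableT (int1 y))).
    by apply: eq_integral => x _; rewrite /f patchE in_setX yA in_setT.
  rewrite -[RHS](@integral0 _ _ _ m1 setT).
  by apply: eq_integral => x _; rewrite /f patchE in_setX (negbTE yA) andbF.
split.
  have := integrable_fubini_F intf.
  by apply: eq_integrable => // x _; rewrite /fubini_F F.
congr fine; rewrite integral_mkcond.
under eq_integral do rewrite -G.
rewrite -(Fubini intf).
by apply: eq_integral => x _; rewrite F.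
Qed.

Lemma lebesgue_stieltjes_measure_ocitv {R : realType} (F : cumulative R R) (x y : R) :
  x <= y -> lebesgue_stieltjes_measure F `]x, y] = (F y - F x)%:E.
Proof.
move=> xy; rewrite /lebesgue_stieltjes_measure /measure_extension/=.
by rewrite measurable_mu_extE/= ?wlength_itv_bnd//; exact: is_ocitv.
Qed.

(** * Characteristic functions: exchanging the two integrals, and tail mass *)

Section CharFun.
Context {R : realType} (F : cumulativeBounded (0 : R) (1 : R)).
Local Notation mu := (lebesgue_stieltjes_measure F).

Lemma Re_char_fun (t : R) : complex.Re (char_fun F t) = \int[mu]_x cos (t * x).
Proof.
by apply: eq_Rintegral => x _; rewrite /= expR0 mul1r mul0r subr0.
Qed.

Lemma Im_char_fun (t : R) : complex.Im (char_fun F t) = \int[mu]_x sin (t * x).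
Proof.
by apply: eq_Rintegral => x _; rewrite /= expR0 mul1r mul0r addr0.
Qed.

(** Meant for [h] = [cos] or [sin] and [c = j]: the argument [c * u * x] is that of the
    characteristic function at [j * u], and [c * (x * u)] that of the polynomial at [x * u]. *)
Lemma harmonic_Fubini (h : R -> R) (s c : R) : continuous h ->
  (forall x, `|h x| <= 1) ->
  mu.-integrable setT
    (EFin \o (fun x => \int[lebesgue_measure]_(u in `[0, s]) h (c * (x * u)))) /\
  \int[lebesgue_measure]_(u in `[0, s]) (\int[mu]_x h (c * u * x)) =
  \int[mu]_x (\int[lebesgue_measure]_(u in `[0, s]) h (c * (x * u))).
Proof.
move=> ch h1.
pose g (z : measurableTypeR R * measurableTypeR R) := h (c * (z.1 * z.2)).
have mg : measurable_fun setT g.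
  apply: measurableT_comp; first exact: continuous_measurable_fun.
  apply: measurable_funM => //; apply: measurable_funM.
    exact: measurable_fst.
  exact: measurable_snd.
have sfin : (lebesgue_measure (`[0%R, s] : set (measurableTypeR R)) < +oo)%E.
  by rewrite lebesgue_measure_itv/=; case: ifP; rewrite ?ltry.
have [] := @Rintegral_bounded_Fubini _ _ _ _ _ mu lebesgue_measure `[0, s] g 1
  (measurable_itv _) sfin mg (fun z => h1 _).
move=> i e; split; first exact: i.
apply: etrans e.
apply: eq_Rintegral => u _; apply: eq_Rintegral => x _.
by rewrite /g/= mulrAC mulrA.
Qed.

(** The integrals are exchanged harmonic by harmonic and recombined by linearity, under both
    integrals. The integrability of [S] is kept for Markov's inequality. *)
Lemma char_fun_trig_comb (k : nat) (a b : nat -> R) (s : R) :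
  let S x := \int[lebesgue_measure]_(u in `[0, s]) trig_poly k a b (x * u) in
  mu.-integrable setT (EFin \o S) /\
  \sum_(0 <= j < k.+1)
      a j * (\int[lebesgue_measure]_(u in `[0, s])
               complex.Re (char_fun F (j%:R * u))) +
  \sum_(1 <= j < k.+1)
      b j * (\int[lebesgue_measure]_(u in `[0, s])
               complex.Im (char_fun F (j%:R * u))) = \int[mu]_x S x.
Proof.
move=> S.
have Hc (j : nat) := harmonic_Fubini _ s j%:R (@continuous_cos R) (@cos_max R).
have Hs (j : nat) := harmonic_Fubini _ s j%:R (@continuous_sin R) (@sin_max R).
have I0 (h : R -> R) (c x : R) : continuous h ->
    lebesgue_measure.-integrable `[0, s] (EFin \o (fun u => h (c * (x * u)))).
  move=> ch; apply: continuous_compact_integrable; first exact: segment_compact.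
  apply: continuous_subspaceT => u.
  apply: (@continuous_comp _ _ _ (fun u => c * (x * u)) h); last exact: ch.
  by apply: cvgM; [exact: cvg_cst|exact: mulrl_continuous].
have SE : S = fun x =>
    \sum_(j <- index_iota 0 k.+1) a j *
      (\int[lebesgue_measure]_(u in `[0, s]) cos (j%:R * (x * u))) +
    \sum_(j <- index_iota 1 k.+1) b j *
      (\int[lebesgue_measure]_(u in `[0, s]) sin (j%:R * (x * u))).
  apply/funext => x.
  have [ic Ec] := Rintegral_lincomb lebesgue_measure _ _ (index_iota 0 k.+1) a
    (fun j u => cos (j%:R * (x * u))) (measurable_itv `[0, s])
    (fun j => I0 _ j%:R x (@continuous_cos R)).
  have [js Es] := Rintegral_lincomb lebesgue_measure _ _ (index_iota 1 k.+1) b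
    (fun j u => sin (j%:R * (x * u))) (measurable_itv `[0, s])
    (fun j => I0 _ j%:R x (@continuous_sin R)).
  by rewrite -Ec -Es -RintegralD.
have [ic Ec] := Rintegral_lincomb mu _ _ (index_iota 0 k.+1) a _
  measurableT (fun j => (Hc j).1).
have [js Es] := Rintegral_lincomb mu _ _ (index_iota 1 k.+1) b _
  measurableT (fun j => (Hs j).1).
rewrite SE; split; first exact: (integrableD measurableT ic js).
have EC (j : nat) :
    \int[lebesgue_measure]_(u in `[0, s]) complex.Re (char_fun F (j%:R * u)) =
    \int[mu]_x (\int[lebesgue_measure]_(u in `[0, s]) cos (j%:R * (x * u))).
  by rewrite -(Hc j).2; apply: eq_Rintegral => u _; rewrite Re_char_fun.
have ES (j : nat) :
    \int[lebesgue_measure]_(u in `[0, s]) complex.Im (char_fun F (j%:R * u)) =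
    \int[mu]_x (\int[lebesgue_measure]_(u in `[0, s]) sin (j%:R * (x * u))).
  by rewrite -(Hs j).2; apply: eq_Rintegral => u _; rewrite Im_char_fun.
under eq_bigr do rewrite EC.
under [X in _ + X = _]eq_bigr do rewrite ES.
by rewrite RintegralD// Ec Es.
Qed.

(** With right-continuous [F], the interval []x, y]] has mass exactly [F y - F x] even if there are
    atoms, and the total mass is 1. *)
Lemma lebesgue_stieltjes_setC_ocitv (x y : R) : x <= y ->
  fine (mu (~` `]x, y])) = 1 - F y + F x.
Proof.
move=> xy; rewrite probability_setC//.
transitivity (fine (1 - (F y - F x)%:E)%E).
  by congr (fine (1 - _)%E); exact: lebesgue_stieltjes_measure_ocitv.
by rewrite -EFinB/= opprB addrCA addrC.
Qed.

End CharFun.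

(** * Markov's inequality and the tail bound *)

(** Integrate the pointwise bound [c * \1_A x <= S x]. *)
Lemma Markov_set {d} {T : measurableType d} {R : realType}
    (mu : {finite_measure set T -> \bar R}) (A : set T) (S : T -> R) (c : R) :
  measurable A -> mu.-integrable setT (EFin \o S) ->
  (forall x, 0 <= S x) -> (forall x, A x -> c <= S x) ->
  c * fine (mu A) <= \int[mu]_x S x.
Proof.
move=> mA iS S0 Sc.
have iA : mu.-integrable setT (EFin \o \1_A) by exact: integrable_indic.
have -> : c * fine (mu A) = \int[mu]_x (c * \1_A x).
  by rewrite RintegralZl// /Rintegral integral_indic// setIT.
apply: le_Rintegral => //; first exact: (integrableZl measurableT c iA).
move=> x _; rewrite indicE; case: (boolP (x \in A)) => xA /=.
  by rewrite mulr1 Sc//; exact: set_mem.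
by rewrite mulr0.
Qed.

Theorem theorem2p1 (R : realType) (k : nat) (a b : nat -> R)
    (Pdeg : trig_degree k a b)
    (Pge0 : forall theta : R, 0 <= trig_poly k a b theta)
    (F : cumulativeBounded (0 : R) (1 : R)) (s : R) (s_gt0 : 0 < s) :
  1 - F (2 * pi / s) + F (- (2 * pi) / s) <=
  2 / (s * a 0%N) *
    (\sum_(0 <= j < k.+1)
        a j * (\int[lebesgue_measure]_(u in `[0, s])
                 complex.Re (char_fun F (j%:R * u))) +
     \sum_(1 <= j < k.+1)
        b j * (\int[lebesgue_measure]_(u in `[0, s])
                 complex.Im (char_fun F (j%:R * u)))).
Proof.
have a0 := trig_poly_coef0_gt0 _ _ _ Pge0 Pdeg.
have [iS ->] := char_fun_trig_comb F k a b s.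
set S := fun x => _ in iS *.
rewrite mulNr; set c := 2 * pi / s.
have c0 : 0 <= c by rewrite divr_ge0 ?mulr_ge0 ?pi_ge0// ltW.
rewrite -lebesgue_stieltjes_setC_ocitv; last by rewrite ge0_cp.
(* Moving the constant to the left makes its inverse [s * a 0 / 2] the Markov threshold. *)
rewrite -ler_pdivrMl ?divr_gt0 ?mulr_gt0// invf_div.
apply: Markov_set => // [|x|x /= xA].
- exact: measurableC.
- by apply: Rintegral_ge0 => u _; exact: Pge0.
apply: Rintegral_trig_poly_ge => //; first exact: ltW.
(* Outside []-c, c]] the absolute value is at least [c], including at the endpoint [-c]: the open
   interval lies inside the half-open one. *)
rewrite leNgt; apply/negP => xc; apply: xA.
by move: xc; rewrite ltr_norml in_itv/= => /andP[-> /ltW].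
Qed.
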